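(* Let $q$ be a prime power and $c\in\mathbb{F}_{q^6}$ with $c^2+c=1$. The $\mathbb{F}_q$-linear set $L_c=\{\langle (x,f(x))\rangle_{\mathbb{F}_{q^6}}\colon x\in\mathbb{F}_{q^6}^*\}$ of rank $6$ of $\mathrm{PG}(1,q^6)$ defined by the $\mathbb{F}_q$-subspace \[U_c=\{(x,\,x^q+x^{q^3}+c x^{q^5})\colon x\in\mathbb{F}_{q^6}\}\subseteq\mathbb{F}_{q^6}\times\mathbb{F}_{q^6}\] is scattered if and only if $q$ is odd. Also, when $q$ is odd and $q\equiv\pm 2\pmod 5$, $L_c$ is not $\mathrm{P\Gamma L}(2,q^6)$-equivalent to any of the previously known maximum scattered $\mathbb{F}_q$-linear sets of $\mathrm{PG}(1,q^6)$, namely those defined by the subspaces $\{(x,x^{q^s})\colon x\in\mathbb{F}_{q^6}\}$ ($\gcd(s,6)=1$), $\{(x,\delta x^{q^s}+x^{q^{6-s}})\colon x\in\mathbb{F}_{q^6}\}$ ($\gcd(s,6)=1$, $\mathrm{N}_{q^6/q}(\delta)\notin\{0,1\}$), and $\{(x,\delta x^{q^s}+x^{q^{s+3}})\colon x\in\mathbb{F}_{q^6}\}$ ($\gcd(s,3)=1$, $\mathrm{N}_{q^6/q^3}(\delta)\notin\{0,1\}$, with $\delta,q$ such that it is maximum scattered).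
   Context: An $\mathbb{F}_q$-linear set of rank $6$ of $\mathrm{PG}(1,q^6)=\mathrm{PG}(\mathbb{F}_{q^6}^2,\mathbb{F}_{q^6})$ is $L_U=\{\langle\mathbf{u}\rangle_{\mathbb{F}_{q^6}}\colon\mathbf{u}\in U\setminus\{\mathbf{0}\}\}$ for a $6$-dimensional $\mathbb{F}_q$-subspace $U$ of $\mathbb{F}_{q^6}^2$. It is (maximum) scattered if $\dim_{\mathbb{F}_q}(U\cap\langle\mathbf{v}\rangle_{\mathbb{F}_{q^6}})\le 1$ for all nonzero $\mathbf{v}$, equivalently $|L_U|=(q^6-1)/(q-1)$. Two linear sets are $\mathrm{P\Gamma L}(2,q^6)$-equivalent if some element of $\mathrm{P\Gamma L}(2,q^6)$ maps one onto the other. $\mathrm{N}_{q^6/q^k}$ denotes the field norm from $\mathbb{F}_{q^6}$ to $\mathbb{F}_{q^k}$. *)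

(* Defs.v *)
From HB Require Import structures.
From mathcomp Require Import all_boot all_order all_algebra all_fingroup all_field.

Set Implicit Arguments.
Unset Strict Implicit.
Unset Printing Implicit Defensive.

Import GRing.Theory.
Local Open Scope ring_scope.

(* F is the field F_q, with q = #|F|, and L is an extension of F, to be taken *)
(* of degree 6; F-subspaces of the plane L x L are terms of {vspace L * L}.   *)

Section LinearSets.

Variables (F : finFieldType) (L : splittingFieldType F).
Implicit Types (U P : {vspace (L * L)%type}) (u v w : L * L).

Definition qpow (i : nat) (x : L) : L := x ^+ (#|F| ^ i).

Fact qpow_is_linear i : linear (qpow i).
Proof.
have [p p_pr pF] := finPcharP F.
have pL : p \in [pchar L] by rewrite pchar_lalg.
have qnat : ([pchar L]).-nat (#|F| ^ i)%N.
  rewrite pnatX (eq_pnat _ (pcharf_eq pL)).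
  by rewrite (card_pprimeChar pF) pnatX pnat_id.
have cE (a : F) : a ^+ (#|F| ^ i) = a.
  by elim: i {qnat} => [|i IHi]; rewrite ?expr1 // expnS exprM expf_card.
by move=> a x y; rewrite /qpow exprDn_pchar // exprZn cE.
Qed.
HB.instance Definition _ i :=
  GRing.isLinear.Build F L L *:%R (qpow i) (qpow_is_linear i).

Definition pair_fun (f g : L -> L) (x : L) : L * L := (f x, g x).

Fact pair_fun_is_linear (f g : {linear L -> L}) : linear (pair_fun f g).
Proof. by move=> a x y; rewrite /pair_fun !linearP. Qed.
HB.instance Definition _ (f g : {linear L -> L}) :=
  GRing.isLinear.Build F L (L * L)%type *:%R (pair_fun f g)
    (pair_fun_is_linear f g).

Definition graph (f : {linear L -> L}) : {vspace (L * L)%type} :=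
  limg (linfun (pair_fun idfun f)).

Lemma mem_graph (f : {linear L -> L}) u :
  u \in graph f <-> exists x, u = (x, f x).
Proof.
split=> [/memv_imgP[x _ ->]|[x ->]]; first by exists x; rewrite lfunE.
by apply/memv_imgP; exists x; rewrite ?memvf // lfunE.
Qed.

(* The L-subspace spanned by v, viewed as an F-subspace.  The points of the   *)
(* projective line over L are the subspaces lspan v with v != 0.              *)
Definition lspan v : {vspace (L * L)%type} :=
  limg (linfun (pair_fun (v.1 \*o idfun) (v.2 \*o idfun))).

Lemma mem_lspan v u :
  u \in lspan v <-> exists a : L, u = (a * v.1, a * v.2).
Proof.
split=> [/memv_imgP[a _ ->]|[a ->]].
  by exists a; rewrite lfunE /= /pair_fun /= !(mulrC a).
by apply/memv_imgP; exists a; rewrite ?memvf // lfunE /= /pair_fun /= !(mulrC a).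
Qed.

Definition linear_set U P : Prop :=
  exists u, [/\ u \in U, u != 0 & P = lspan u].

Definition scattered U : Prop :=
  forall v, v != 0 -> (\dim (U :&: lspan v) <= 1)%N.

Definition semilinear_map (A : 'M[L]_2) (s : {rmorphism L -> L}) u : L * L :=
  (A 0 0 * s u.1 + A 0 1 * s u.2, A 1 0 * s u.1 + A 1 1 * s u.2).

(* A ring endomorphism s of L is an automorphism because L is finite.         *)
Definition PGammaL_equivalent (X Y : {vspace (L * L)%type} -> Prop) : Prop :=
  exists (A : 'M[L]_2) (s : {rmorphism L -> L}), A \in unitmx /\
    forall Q, Y Q <->
      exists2 P, X P &
        forall w, w \in Q <-> exists2 u, u \in P & w = semilinear_map A s u.

End LinearSets.

Arguments qpow {F L} i x.
Arguments graph {F L} f.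
Arguments linear_set {F L} U P.
Arguments scattered {F L} U.
Arguments PGammaL_equivalent {F L} X Y.

(* Main.v *)
From HB Require Import structures.
Require Import Defs.
From mathcomp Require Import all_boot all_order all_algebra all_fingroup all_field.
From mathcomp Require Import cyclic ring zify.

Set Implicit Arguments.
Unset Strict Implicit.
Unset Printing Implicit Defensive.

Import GRing.Theory.
Local Open Scope ring_scope.

(** Write x_i for x^(q^i), f(x) = x_1 + x_3 + c x_5, c' = c^q (a root of the
    same quadratic), and D_ij = x_i y_j - x_j y_i.

    If (x, f x) and (y, f y) are L-collinear, the relation
    D_01 + D_03 + c D_05 = 0 and its conjugates express the v_k = D_(k,k+3) in
    terms of the u_k = D_(k,k+1).  By the Plucker relations a determinant in the
    u_k and v_k vanishes, and under these relations it is a product of three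
    conjugate linear forms (up to a factor 2 when c' <> c); for q odd this
    forces u_0 = 0.  For q even, c^3 = 1 and there is a nonzero l with
    l_3 = c l_1, so that f(l x) = l_1 (c - 1) x whenever x is an element of
    F_(q^3) of trace 0.

    For the inequivalence, q = +-2 mod 5 gives c' = -1 - c.  If the linear set
    is the image of that of g, then it is also the linear set of the graph of
    the map h with h(al y + be g(y)) = ga y + de g(y), and
    h(x) = sum_i h_i x_i.  Comparing the sums over x <> 0 of
    (h(x)/x)^k and (f(x)/x)^k for k = 1, 1+q, 1+q^2, 1+q^3, 1+q+q^2 yields
    h_0 = h_2 = h_4 = 0, h_1 (h_5)_1 = c' and h_3 (h_3)_3 = 1.  With these,
    comparing coefficients in the functional equation for h is contradictory
    for each of the three families. *)

(** * Scatteredness *)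

Section Identities.

Variable R : idomainType.

(* The determinant with rows [-v1, u0, -u1], [-u3, v0, u2], [u4, -u5, v2]: by   *)
(* Plucker, these rows annihilate the vector (D_02, D_24, D_40).                *)
Lemma plucker_det (x0 x1 x2 x3 x4 x5 y0 y1 y2 y3 y4 y5 : R)
    (D := fun a b a' b' : R => a * b' - a' * b) :
  let u0 := D x0 y0 x1 y1 in let u1 := D x1 y1 x2 y2 in
  let u2 := D x2 y2 x3 y3 in let u3 := D x3 y3 x4 y4 in
  let u4 := D x4 y4 x5 y5 in let u5 := D x5 y5 x0 y0 in
  let v0 := D x0 y0 x3 y3 in let v1 := D x1 y1 x4 y4 in
  let v2 := D x2 y2 x5 y5 in
  v1 * (v0 * v2 + u2 * u5) - u0 * (u3 * v2 + u2 * u4)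
    + u1 * (u3 * u5 - v0 * u4) = 0.
Proof. rewrite /D /=; ring. Qed.

Variables (c u0 u1 u2 u3 u4 u5 v0 v1 v2 : R).
Hypotheses (hc : c ^+ 2 + c = 1) (char2 : 2%:R != 0 :> R).
Hypothesis det0 : v1 * (v0 * v2 + u2 * u5) - u0 * (u3 * v2 + u2 * u4)
    + u1 * (u3 * u5 - v0 * u4) = 0.

Let hc0 : c ^+ 2 + c - 1 = 0.
Proof. by rewrite hc subrr. Qed.

Lemma golden_neq0 : c != 0.
Proof.
by apply: contra_eq_neq hc => ->; rewrite expr0n addr0 eq_sym oner_neq0.
Qed.

Lemma golden_neq1 : c != 1.
Proof.
apply: contraNneq char2 => c1; move/eqP: hc; rewrite c1 expr1n.
by rewrite -subr_eq0 addrK oner_eq0.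
Qed.

(** Case c' = c. Adding the relations in pairs shows that each u_k + u_(k+3) is c times another one,
    cyclically, so u_0 + u_3 is c^3 times itself. Since c^3 - 1 = 2 (c - 1), all three sums vanish,
    and the determinant factors. *)
Lemma det_rational_root :
    v0 = c * u5 - u0 -> v1 = c * u0 - u1 -> v2 = c * u1 - u2 ->
    - v0 = c * u2 - u3 -> - v1 = c * u3 - u4 -> - v2 = c * u4 - u5 ->
  u3 = - u0 /\ (c * u0 - u1) * (u2 - c * u1) * (c * u2 + u0) = 0.
Proof.
move=> e0 e1 e2 e3 e4 e5.
have t0 : u0 + u3 = c * (u2 + u5).
  by apply: subr0_eq; rewrite -oppr0 -(subrr v0) {1}e0 -[v0 in RHS]opprK e3; ring.
have t1 : u1 + u4 = c * (u0 + u3).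
  by apply: subr0_eq; rewrite -oppr0 -(subrr v1) {1}e1 -[v1 in RHS]opprK e4; ring.
have t2 : u2 + u5 = c * (u1 + u4).
  by apply: subr0_eq; rewrite -oppr0 -(subrr v2) {1}e2 -[v2 in RHS]opprK e5; ring.
have t00 : u0 + u3 = 0.
  have : 2%:R * (c - 1) * (u0 + u3) = 0.
    have -> : 2%:R * (c - 1) = c ^+ 3 - 1 - (c - 1) * (c ^+ 2 + c - 1) by ring.
    by rewrite hc0 mulr0 subr0 mulrBl mul1r {2}t0 t2 t1; ring.
  by move/eqP; rewrite !mulf_eq0 (negPf char2) subr_eq0 (negPf golden_neq1) => /eqP.
have t10 : u1 + u4 = 0 by rewrite t1 t00 mulr0.
have t20 : u2 + u5 = 0 by rewrite t2 t10 mulr0.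
have e_3 : u3 = - u0 by apply/eqP; rewrite -addr_eq0 addrC t00.
have e_4 : u4 = - u1 by apply/eqP; rewrite -addr_eq0 addrC t10.
have e_5 : u5 = - u2 by apply/eqP; rewrite -addr_eq0 addrC t20.
split=> //; move: det0; rewrite e0 e1 e2 e_3 e_4 e_5 => det.
(* Modulo c^2 + c - 1 the determinant is -c times the product; the long factor is the cofactor of
   c^2 + c - 1 in the difference. *)
apply/eqP; rewrite -(mulrI_eq0 _ (lregP golden_neq0)) -oppr_eq0 -det -subr_eq0.
rewrite -[X in _ == X](mulr0 (c * (u1 * u0 ^+ 2 - u0 * u2 ^+ 2 - u1 ^+ 2 * u2)
  + (c ^+ 2 + 1) * (u0 * u1 * u2) - u0 * u1 ^+ 2 - u0 ^+ 2 * u2 + u1 * u2 ^+ 2)).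
by rewrite -hc0; apply/eqP; ring.
Qed.

(** Case c' = -1 - c. The sums T_k = u_k + u_(k+3) are also combinations of the u_k with
    coefficients c and c'. Solving for the u_k, with d = c - c' = 2 c + 1, makes every d u_k and d
    v_k a linear form in T_0, T_1, T_2. *)
Lemma det_conjugate_roots :
    v0 = c * u5 - u0 -> v1 = (-1 - c) * u0 - u1 -> v2 = c * u1 - u2 ->
    - v0 = (-1 - c) * u2 - u3 -> - v1 = c * u3 - u4 ->
    - v2 = (-1 - c) * u4 - u5 ->
  (2%:R * c + 1) * u0 = c * (u0 + u3) - (u1 + u4) /\
  (u0 + u3 + (u1 + u4)) * (u1 + u4 + (u2 + u5)) * (u2 + u5 + (u0 + u3)) = 0.
Proof.
move=> e0 e1 e2 e3 e4 e5; pose d := 2%:R * c + 1.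
have t0 : u0 + u3 = c * u5 + (-1 - c) * u2.
  by apply: subr0_eq; rewrite -oppr0 -(subrr v0) {1}e0 -[v0 in RHS]opprK e3; ring.
have t1 : u1 + u4 = (-1 - c) * u0 + c * u3.
  by apply: subr0_eq; rewrite -oppr0 -(subrr v1) {1}e1 -[v1 in RHS]opprK e4; ring.
have t2 : u2 + u5 = c * u1 + (-1 - c) * u4.
  by apply: subr0_eq; rewrite -oppr0 -(subrr v2) {1}e2 -[v2 in RHS]opprK e5; ring.
have E0 : d * u0 = c * (u0 + u3) - (u1 + u4) by rewrite t1 /d; ring.
have E1 : d * u1 = (u2 + u5) - (-1 - c) * (u1 + u4) by rewrite t2 /d; ring.
have E2 : d * u2 = c * (u2 + u5) - (u0 + u3) by rewrite t0 /d; ring.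
have E3 : d * u3 = (u1 + u4) - (-1 - c) * (u0 + u3) by rewrite t1 /d; ring.
have E4 : d * u4 = c * (u1 + u4) - (u2 + u5) by rewrite t2 /d; ring.
have E5 : d * u5 = (u0 + u3) - (-1 - c) * (u2 + u5) by rewrite t0 /d; ring.
have G0 : d * v0 = u1 + u4 + (u2 + u5).
  transitivity (u1 + u4 + (c ^+ 2 + c) * (u2 + u5)); last by rewrite hc mul1r.
  by rewrite e0 mulrBr mulrCA E5 E0; ring.
have G1 : d * v1 = - (u0 + u3 + (u2 + u5)).
  transitivity (- ((c ^+ 2 + c) * (u0 + u3) + (u2 + u5))); last by rewrite hc mul1r.
  by rewrite e1 mulrBr mulrCA E0 E1; ring.
have G2 : d * v2 = u0 + u3 + (u1 + u4).
  transitivity (u0 + u3 + (c ^+ 2 + c) * (u1 + u4)); last by rewrite hc mul1r.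
  by rewrite e2 mulrBr mulrCA E1 E2; ring.
split=> //.
move: (u0 + u3) (u1 + u4) (u2 + u5) E0 E1 E2 E3 E4 E5 G0 G1 G2 => T0 T1 T2.
move=> E0 E1 E2 E3 E4 E5 G0 G1 G2.
(* Distributing d^3 over the determinant puts these forms in its entries; modulo c^2 + c - 1 the
   result is twice the product. *)
have : d ^+ 3 * 0 = 0 by rewrite mulr0.
rewrite -[X in _ * X]det0.
have -> : d ^+ 3 * (v1 * (v0 * v2 + u2 * u5)
      - u0 * (u3 * v2 + u2 * u4) + u1 * (u3 * u5 - v0 * u4)) =
    d * v1 * ((d * v0) * (d * v2) + (d * u2) * (d * u5))
      - (d * u0) * ((d * u3) * (d * v2) + (d * u2) * (d * u4))
      + (d * u1) * ((d * u3) * (d * u5) - (d * v0) * (d * u4)) by ring.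
rewrite E0 E1 E2 E3 E4 E5 G0 G1 G2 => det.
apply/eqP; rewrite -(mulrI_eq0 _ (lregP char2)) -det -subr_eq0.
rewrite -[X in _ == X](mulr0 (T0 ^+ 3 + T1 ^+ 3 + T2 ^+ 3 - 3%:R * (T0 * T1 * T2)
  - T0 * T2 ^+ 2 - T0 ^+ 2 * T1 - T1 ^+ 2 * T2)).
by rewrite -hc0; apply/eqP; ring.
Qed.

End Identities.

(** * Frobenius conjugates, and scatteredness for q odd *)

Section Frobenius.

Variables (F : finFieldType) (L : splittingFieldType F).

Fact qpow_is_monoid_morphism i : monoid_morphism (qpow i : L -> L).
Proof. by split=> [|x y]; rewrite /qpow ?expr1n ?exprMn. Qed.
HB.instance Definition _ i :=
  GRing.isMonoidMorphism.Build L L (qpow i) (qpow_is_monoid_morphism i).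

Lemma qpow0 (x : L) : qpow 0 x = x.
Proof. by rewrite /qpow expn0 expr1. Qed.

Lemma qpow_qpow i j (x : L) : qpow i (qpow j x) = qpow (i + j) x.
Proof. by rewrite /qpow -exprM -expnD addnC. Qed.

Lemma mem_subfield_qpow (K : {subfield L}) (x : L) :
  (x \in K) = (qpow (\dim K) x == x).
Proof. by rewrite Fermat's_little_theorem. Qed.

Hypothesis dimL : \dim {:L} = 6%N.

Lemma qpow6 (x : L) : qpow 6 x = x.
Proof.
by apply/eqP; rewrite -dimL -(mem_subfield_qpow {:L}%AS) memvf.
Qed.

Lemma qpow_mod6 i (x : L) : qpow (i + 6) x = qpow i x.
Proof. by rewrite -qpow_qpow qpow6. Qed.

Lemma qpow_modn i (x : L) : qpow i x = qpow (i %% 6) x.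
Proof.
rewrite {1}(divn_eq i 6); elim: (i %/ 6)%N => // k IHk.
by rewrite mulSn -addnA addnC qpow_mod6.
Qed.

Variable c : L.
Hypothesis hc : c ^+ 2 + c = 1.

Lemma qpow_root i : qpow i c ^+ 2 + qpow i c = 1.
Proof. by rewrite -rmorphXn -rmorphD hc rmorph1. Qed.

Lemma qpow1_root : qpow 1 c = c \/ qpow 1 c = -1 - c.
Proof.
have /eqP : (qpow 1 c - c) * (qpow 1 c + c + 1) = 0.
  transitivity (qpow 1 c ^+ 2 + qpow 1 c - (c ^+ 2 + c)); first by ring.
  by rewrite (qpow_root 1) hc subrr.
rewrite mulf_eq0 => /orP[/eqP/subr0_eq|/eqP e]; first by left.
by right; apply: subr0_eq; rewrite -[RHS]e; ring.
Qed.

(** For x nonzero the conclusion says that y / x is fixed by the Frobenius map. The hypothesis is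
    one linear relation among the [D i j]; its conjugates, with coefficients alternating between c
    and c', feed the determinant lemmas. *)
Lemma collinear_same_ratio (x y : L) : 2%:R != 0 :> L ->
    x * (qpow 1 y + qpow 3 y + c * qpow 5 y) =
      y * (qpow 1 x + qpow 3 x + c * qpow 5 x) ->
  x * qpow 1 y - qpow 1 x * y = 0.
Proof.
move=> char2 exy.
pose X i := qpow i x; pose Y i := qpow i y.
pose D i j := X i * Y j - X j * Y i.
have qD k i j : qpow k (D i j) = D (k + i)%N (k + j)%N.
  by rewrite rmorphB !rmorphM /= !qpow_qpow.
have D6 i j : D (i + 6)%N j = D i j by rewrite /D /X /Y !qpow_mod6.
have DN i j : D i j = - D j i by rewrite /D; ring.
have D6r i j : D i (j + 6)%N = D i j by rewrite DN D6 -DN.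
pose cc := qpow 1 c.
have qcc : qpow 1 cc = c.
  rewrite /cc; case: qpow1_root => e; rewrite !e // rmorphB rmorphN1 /= e; ring.
have e0 : D 0 3 = c * D 5 0 - D 0 1.
  apply: subr0_eq; transitivity (x * (qpow 1 y + qpow 3 y + c * qpow 5 y) -
      y * (qpow 1 x + qpow 3 x + c * qpow 5 x)); last by rewrite exy subrr.
  by rewrite /D /X /Y !qpow0; ring.
have step a i j k l m n : D i j = a * D k l - D m n ->
    D i.+1 j.+1 = qpow 1 a * D k.+1 l.+1 - D m.+1 n.+1.
  by move=> e; rewrite -[LHS](qD 1 i j) e rmorphB rmorphM /= !qD !add1n.
have e1 : D 1 4 = cc * D 0 1 - D 1 2 by rewrite (step _ _ _ _ _ _ _ e0) (D6 0).
have e2 : D 2 5 = c * D 1 2 - D 2 3 by rewrite (step _ _ _ _ _ _ _ e1) qcc.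
(* Indices are cyclic modulo 6 and [D] is antisymmetric, so [D 3 6] is [D 3 0], that is [- D 0 3];
   [e4] and [e5] are similar. *)
have e3 : - D 0 3 = cc * D 2 3 - D 3 4.
  by rewrite -DN -(D6r 3 0) (step _ _ _ _ _ _ _ e2).
have e4 : - D 1 4 = c * D 3 4 - D 4 5.
  have e : D 3 6 = cc * D 2 3 - D 3 4 by rewrite (D6r 3 0) DN.
  by rewrite -DN -(D6r 4 1) (step _ _ _ _ _ _ _ e) qcc.
have e5 : - D 2 5 = cc * D 4 5 - D 5 0.
  have e : D 4 7 = c * D 3 4 - D 4 5 by rewrite (D6r 4 1) DN.
  by rewrite -DN -(D6r 5 2) -(D6r 5 0) (step _ _ _ _ _ _ _ e).
have det0 : D 1 4 * (D 0 3 * D 2 5 + D 2 3 * D 5 0)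
    - D 0 1 * (D 3 4 * D 2 5 + D 2 3 * D 4 5)
    + D 1 2 * (D 3 4 * D 5 0 - D 0 3 * D 4 5) = 0.
  exact: (plucker_det (X 0) (X 1) (X 2) (X 3) (X 4) (X 5)
                      (Y 0) (Y 1) (Y 2) (Y 3) (Y 4) (Y 5)).
have -> : x * qpow 1 y - qpow 1 x * y = D 0 1 by rewrite /D /X /Y !qpow0.
clearbody D.
have [ecc|cc_neq] := eqVneq cc c.
  rewrite ecc in e1 e3 e5; have [u3 /eqP] := det_rational_root hc char2 det0 e0 e1 e2 e3 e4 e5.
  (* If u_1 = c u_0, conjugation gives u_3 = c^3 u_0, while u_3 = -u_0; and c^3 + 1 = 2 c. *)
  have key : D 1 2 = c * D 0 1 -> D 0 1 = 0.
    have q1 k : D k.+1 k.+2 = c * D k k.+1 -> D k.+2 k.+3 = c * D k.+1 k.+2.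
      by move=> e; rewrite -[LHS](qD 1 k.+1 k.+2) e rmorphM /= -/cc ecc qD add1n -e.
    move=> h; have h2 := q1 _ h; have h3 := q1 _ h2.
    have : 2%:R * c * D 0 1 = 0.
      have -> : 2%:R * c * D 0 1 = c ^+ 3 * D 0 1 + D 0 1
          - (c - 1) * (c ^+ 2 + c - 1) * D 0 1 by ring.
      rewrite hc subrr mulr0 mul0r subr0; move: u3; rewrite h3 h2 h => u3.
      by rewrite -[X in _ + X]opprK -u3; ring.
    by move/eqP; rewrite !mulf_eq0 (negPf char2) (negPf (golden_neq0 hc)) => /eqP.
  have qw k : qpow k (D 1 2 - c * D 0 1) = D k.+1 k.+2 - c * D k k.+1.
    have qck : qpow k c = c.
      by elim: k => [|k IHk]; rewrite ?qpow0 // -[k.+1]add1n -qpow_qpow IHk.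
    by rewrite rmorphB rmorphM /= qck !qD addn0 addn1 addn2.
  (* Up to sign the three factors are conjugates of u_1 - c u_0. *)
  move=> h; apply: key; apply/eqP; rewrite -subr_eq0.
  move: h; rewrite !mulf_eq0 -orbA => /or3P[] h.
  - by rewrite -opprB oppr_eq0.
  - by rewrite -(fmorph_eq0 (qpow 1)) /= qw.
  - rewrite -(fmorph_eq0 (qpow 2)) /= qw.
    rewrite u3 -opprD oppr_eq0 addrC.
    exact: h.
have ecc : cc = -1 - c by case: qpow1_root => // e; rewrite /cc e eqxx in cc_neq.
rewrite ecc in e1 e3 e5; have [] := det_conjugate_roots hc char2 det0 e0 e1 e2 e3 e4 e5.
set t0 := D 0 1 + D 3 4; set t1 := D 1 2 + D 4 5.
set t2 := D 2 3 + D 5 0.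
have qt0 : qpow 1 t0 = t1 by rewrite rmorphD /= !qD.
have qt1 : qpow 1 t1 = t2 by rewrite rmorphD /= !qD (D6r 5 0).
have qt2 : qpow 1 t2 = t0 by rewrite rmorphD /= !qD (D6 0) addrC.
move=> d01 h.
(* Frobenius permutes [t0], [t1], [t2] cyclically, so t1 = -t0 whichever factor vanishes. Three
   applications fix [t0] but change its sign three times, hence t0 = 0. *)
have t10 : t1 = - t0.
  apply/eqP; rewrite -addr_eq0 addrC; move/eqP: h.
  rewrite !mulf_eq0 -orbA => /or3P[] // h.
    by rewrite -(fmorph_eq0 (qpow 1)) rmorphD /= qt0 qt1.
  by rewrite -(fmorph_eq0 (qpow 2)) rmorphD /= -!(qpow_qpow 1 1) qt0 qt1 qt2.
have t20 : t2 = t0 by rewrite -qt1 t10 rmorphN /= qt0 t10 opprK.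
have t00 : t0 = 0.
  have t0N : t0 = - t0 by rewrite -t10 -qt0 -[in RHS]t20 qt2.
  have : 2%:R * t0 = 0 by rewrite mulr_natl mulr2n {1}t0N addNr.
  by move/eqP; rewrite mulf_eq0 (negPf char2) => /eqP.
move/eqP: d01; rewrite t10 t00 oppr0 mulr0 subrr mulf_eq0 => /orP[|/eqP//].
move=> /eqP d0; case/eqP: cc_neq; rewrite ecc; apply: subr0_eq.
by rewrite -[RHS]oppr0 -d0; ring.
Qed.

(** Two vectors of the graph on one point satisfy x f(y) = y f(x), so their ratio is fixed by
    Frobenius and lies in F: any nonzero vector of the intersection spans it over F. *)
Lemma scattered_graph (f : {linear L -> L}) :
    (forall x y : L, x * f y = y * f x -> x * qpow 1 y - qpow 1 x * y = 0) ->
  scattered (graph f).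
Proof.
move=> col v v0; set W := (_ :&: _)%VS.
have [->|W0] := eqVneq W 0%VS; first by rewrite dimv0.
have : vpick W \in W := memv_pick W.
have : vpick W != 0 by rewrite vpick0.
move: (vpick W) => w w0 wW.
suff sW : (W <= <[w]>)%VS by rewrite (leq_trans (dimvS sW)) // dim_vline; case: eqP.
have grW u : u \in W -> exists x a, [/\ u = (x, f x), x = a * v.1 & f x = a * v.2].
  rewrite memv_cap => /andP[/mem_graph[x ->] /mem_lspan[a [e1 e2]]].
  by exists x, a.
case/grW: (wW) => x [a [w_x xa fxa]].
have x0 : x != 0.
  by apply: contraNneq w0 => x0; rewrite w_x x0 linear0.
apply/subvP=> u /grW[y [b [-> yb fyb]]].
have : x * f y = y * f x by rewrite fxa fyb xa yb; ring.
move/col/subr0_eq => e.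
(* [1%AS] is the copy of F in L, so its elements are the fixed points of [qpow 1]. *)
have dim1 : \dim (1%AS : {subfield L}) = 1%N := dimv1 L.
have : qpow (\dim (1%AS : {subfield L})) (y / x) == y / x.
  rewrite dim1 fmorph_div /= (can2_eq (divfK _) (mulfK _)) ?fmorph_eq0 //.
  by rewrite mulrAC (mulrC y) -e mulrAC mulfV // mul1r.
rewrite -mem_subfield_qpow => /vlineP[k /(canRL (divfK x0))].
rewrite mulr_algl => yk; apply/vlineP; exists k.
by rewrite w_x yk linearZ.
Qed.

End Frobenius.

(** * q-polynomials, and non-scatteredness for q even *)

Section QPolynomials.

Variables (F : finFieldType) (L : splittingFieldType F).
Hypothesis dimL : \dim {:L} = 6%N.

Lemma card_degree6 : #|finvect_type L| = (#|F| ^ 6)%N.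
Proof.
have /= <- := card_vspacef (Vector.class (finvect_type L)).
by rewrite card_vspace -dimL.
Qed.

Lemma dim_graph (f : {linear L -> L}) : \dim (graph f) = 6%N.
Proof.
rewrite limg_dim_eq ?dimL //; apply/eqP; rewrite -subv0; apply/subvP=> x.
rewrite memv_cap memv_ker lfunE /= xpair_eqE memv0.
by case/and3P.
Qed.

(** The associated polynomial has degree at most q^5 but vanishes at all q^6 elements of L. *)
Lemma qpoly_eq0 (a : 'I_6 -> L) :
  (forall x, \sum_i a i * qpow i x = 0) -> forall i, a i = 0.
Proof.
move=> a0 i; pose p : {poly L} := \sum_i a i *: 'X^(#|F| ^ i).
have q_gt1 := finNzRing_gt1 F.
have p0 : p = 0.
  apply/eqP/negPn/negP=> p_neq0.
  pose s : seq L := enum (finvect_type L).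
  have us : uniq s := enum_uniq (finvect_type L).
  have rs : all (root p) s.
    apply/allP=> x _; apply/rootP; rewrite horner_sum -[RHS](a0 x).
    by apply: eq_bigr => j _; rewrite hornerZ hornerXn.
  have sz : size s = (#|F| ^ 6)%N by rewrite -card_degree6 cardE.
  have := max_poly_roots p_neq0 rs us; rewrite sz ltnNge (leq_trans (size_sum _ _ _)) //.
  apply/bigmax_leqP=> j _; rewrite (leq_trans (size_scale_leq _ _)) // size_polyXn.
  by rewrite ltn_exp2l.
have := coef0 L (#|F| ^ i); rewrite -p0 coef_sum (bigD1 i) //= big1 ?addr0.
  by rewrite coefZ coefXn eqxx mulr1.
move=> j /negPf j_neq; rewrite coefZ coefXn eqn_exp2l // (eq_sym (i : nat)) [_ == _]j_neq mulr0.
by [].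
Qed.

Definition qpoly_lfun (a : {ffun 'I_6 -> L}) : 'End(L) :=
  \sum_i (amull (a i) \o linfun (qpow i))%VF.

Lemma qpoly_lfunE a x : qpoly_lfun a x = \sum_i a i * qpow i x.
Proof.
rewrite sum_lfunE; apply: eq_bigr => i _.
by rewrite comp_lfunE !lfunE.
Qed.

Fact qpoly_lfun_is_linear : linear qpoly_lfun.
Proof.
move=> k a b; apply/lfunP=> x; rewrite add_lfunE scale_lfunE !qpoly_lfunE.
rewrite scaler_sumr -big_split; apply: eq_bigr => i _ /=.
by rewrite !ffunE mulrDl scalerAl.
Qed.
HB.instance Definition _ := GRing.isLinear.Build F {ffun 'I_6 -> L} 'End(L) *:%R
  qpoly_lfun qpoly_lfun_is_linear.

(** Sending coefficients to endomorphisms is F-linear and injective between two spaces of dimension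
    36, hence onto. *)
Lemma qpoly_of_lfun (h : 'End(L)) :
  exists a : 'I_6 -> L, forall x, h x = \sum_i a i * qpow i x.
Proof.
pose Phi := linfun qpoly_lfun.
have kerPhi : lker Phi = 0%VS.
  apply/eqP; rewrite -subv0; apply/subvP=> a.
  rewrite memv_ker lfunE /= memv0 => /eqP a0; apply/eqP/ffunP=> i; rewrite ffunE.
  by apply: (@qpoly_eq0 a) => x; rewrite -qpoly_lfunE a0 zero_lfunE.
have : limg Phi = fullv.
  apply/eqP; rewrite eqEdim subvf /= limg_dim_eq ?kerPhi ?capv0 //.
  by rewrite !dimvf leq_mul2r card_ord -dimL dimvf leqnn orbT.
move=> imPhi; have : h \in limg Phi by rewrite imPhi memvf.
case/memv_imgP=> a _ ->; exists a => x.
by rewrite lfunE /= qpoly_lfunE.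
Qed.

Variables (K : {subfield L}) (c : L).
Hypotheses (dimK : \dim K = 3%N) (hc : c ^+ 2 + c = 1).

Lemma not_scattered_char2 : 2%:R = 0 :> L ->
  ~ scattered (graph (qpow 1 \+ qpow 3 \+ c \*o qpow 5 : L -> L)).
Proof.
move=> char2 scat.
have c3 : c ^+ 3 = 1.
  transitivity (2%:R * (c - 1) + 1 + (c - 1) * (c ^+ 2 + c - 1)); first by ring.
  by rewrite hc char2; ring.
have qc2 : qpow 2 c = c.
  rewrite -(qpow_qpow 1 1); have [e|e] := qpow1_root hc; rewrite !e ?e //.
  by rewrite rmorphB rmorphN1 /= e; ring.
(* Hilbert 90 for c, as c c_2 c_4 = c^3 = 1: [qpow 2] multiplies [y_m y] by c, and [y_m] is not
   identically zero by [qpoly_eq0]. *)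
have [m m_neq0 m2] : exists2 m : L, m != 0 & qpow 2 m = c * m.
  pose y_m (y : L) := y + c ^+ 2 * qpow 2 y + c * qpow 4 y.
  suff [y y_neq0] : exists y, y_m y != 0.
    exists (y_m y); rewrite // /y_m !rmorphD (rmorphM _ (c ^+ 2)).
    rewrite (rmorphM _ c) rmorphXn /= qc2 !qpow_qpow (qpow6 dimL).
    transitivity (c ^+ 3 * qpow 2 y + c ^+ 2 * qpow 4 y + c * y); last by ring.
    by rewrite c3 mul1r. 
  have [y /= y_neq0|all0] := pickP (fun y : finvect_type L => y_m y != 0).
    by exists y.
  pose a (i : 'I_6) := [:: 1; 0; c ^+ 2; 0; c; 0]`_i.
  suff /qpoly_eq0/(_ ord0)/eqP : forall x, \sum_i a i * qpow i x = 0.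
    by rewrite /a /= oner_eq0.
  move=> x; rewrite !big_ord_recl big_ord0 /a /=.
  have /negbFE/eqP e := all0 x; rewrite -[RHS]e /y_m.
  by rewrite !mul0r !add0r addr0 mul1r qpow0 addrA.
pose l := qpow 5 m.
have l1 : qpow 1 l = m by rewrite qpow_qpow qpow6.
have l3 : qpow 3 l = c * m by rewrite -(qpow_qpow 2 1) l1.
have l5 : qpow 5 l = c ^+ 2 * m by rewrite -(qpow_qpow 2 3) l3 rmorphM /= qc2 m2 mulrA.
pose v := (l, m * (c - 1)).
have v_neq0 : v != 0 by rewrite xpair_eqE negb_and fmorph_eq0 m_neq0.
pose T := (K :&: lker (linfun (idfun \+ qpow 1 \+ qpow 2)))%VS.
(* The trace maps K into F, so its kernel in K has dimension at least 3 - 1. *)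
have dimT : (2 <= \dim T)%N.
  set phi := linfun _ in T *.
  have : (\dim T + \dim (phi @: K) = 3)%N by rewrite limg_ker_dim.
  suff : (\dim (phi @: K) <= 1)%N by move: (\dim _) (\dim _) => a b; lia.
  rewrite -[X in (_ <= X)%N](dimv1 L); apply/dimvS/subvP=> _ /memv_imgP[x xK ->].
  rewrite (mem_subfield_qpow 1%AS) (dimv1 L) lfunE /= !rmorphD /= !qpow_qpow.
  by move: xK; rewrite mem_subfield_qpow dimK => /eqP->; apply/eqP; ring.
have := scat v v_neq0; apply/negP; rewrite -ltnNge (leq_trans dimT) //.
(* Scaling [v] by the elements of [T] embeds [T] into the intersection. *)
set g := linfun (pair_fun (v.1 \*o idfun) (v.2 \*o idfun)).
rewrite -(@limg_dim_eq _ _ _ g).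
  apply/dimvS/subvP=> _ /memv_imgP[x + ->]; rewrite memv_cap memv_ker => /andP[xK].
  rewrite !lfunE /= => /eqP xT; rewrite memv_cap; apply/andP; split; last first.
    by apply/mem_lspan; exists x; rewrite /pair_fun /= !(mulrC x).
  apply/mem_graph; exists (l * x); congr pair => /=.
  have x3 : qpow 3 x = x by apply/eqP; rewrite -dimK -mem_subfield_qpow.
  rewrite !rmorphM /= l1 l3 l5 x3 -(qpow_qpow 2 3) x3.
  transitivity (m * (c - 1) * x + m * (x + qpow 1 x + qpow 2 x)
    + (c ^+ 3 - 1) * m * qpow 2 x); last by ring.
  by rewrite xT c3; ring.
apply/eqP; rewrite -subv0; apply/subvP=> x.
rewrite memv_cap memv_ker lfunE /= xpair_eqE memv0 => /and3P[_ + _].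
by rewrite mulf_eq0 fmorph_eq0 (negPf m_neq0).
Qed.

End QPolynomials.

(** * Equivalence *)

Section Equivalence.

Variables (F : finFieldType) (L : splittingFieldType F).

Lemma rmorph_surj (s : {rmorphism L -> L}) y : exists x, s x = y.
Proof.
have [t _ sK] := @injF_bij (finvect_type L) s (fmorph_inj s).
by exists (t y); apply: sK.
Qed.

(** The points of the linear set of a graph are recorded by the ratios f(x) / x, and f' is f
    conjugated by s. The inverse of A sends (y, g y), for y nonzero, to a nonzero multiple of some
    (x, f' x) with x nonzero. Hence the first coordinate of the image is an injective function p of
    y, and h is the second coordinate composed with the inverse of p. *)
Lemma PGammaL_same_ratios (f f' g : {linear L -> L}) (A : 'M[L]_2)
    (s : {rmorphism L -> L}) : A \in unitmx -> (forall x, f' (s x) = s (f x)) ->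
    (forall Q, linear_set (graph g) Q <-> exists2 P, linear_set (graph f) P &
       forall w, w \in Q <-> exists2 u, u \in P & w = semilinear_map A s u) ->
  exists al be ga de : L, (forall y, y != 0 -> al * y + be * g y != 0) /\
    exists h : 'End(L), (forall y, h (al * y + be * g y) = ga * y + de * g y) /\
      forall m, (exists2 x, x != 0 & f' x = m * x) <->
                (exists2 x, x != 0 & h x = m * x).
Proof.
move=> uA f's eqL; pose B := invmx A.
have BA := mulVmx uA.
have BAE i j : B i 0 * A 0 j + B i 1 * A 1 j = (i == j)%:R.
  have /matrixP/(_ i j) := BA; rewrite !mxE !big_ord_recl big_ord0 addr0.
  by rewrite (_ : lift _ _ = 1) //; apply: val_inj.
have B0 u v : B 0 0 * (A 0 0 * u + A 0 1 * v) + B 0 1 * (A 1 0 * u + A 1 1 * v) = u.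
  transitivity ((B 0 0 * A 0 0 + B 0 1 * A 1 0) * u + (B 0 0 * A 0 1 + B 0 1 * A 1 1) * v).
    by ring.
  by rewrite !BAE mul1r mul0r addr0.
have B1 u v : B 1 0 * (A 0 0 * u + A 0 1 * v) + B 1 1 * (A 1 0 * u + A 1 1 * v) = v.
  transitivity ((B 1 0 * A 0 0 + B 1 1 * A 1 0) * u + (B 1 0 * A 0 1 + B 1 1 * A 1 1) * v).
    by ring.
  by rewrite !BAE mul1r mul0r add0r.
exists (B 0 0), (B 0 1), (B 1 0), (B 1 1).
have fwd y : y != 0 -> exists a x, [/\ a != 0, x != 0,
    B 0 0 * y + B 0 1 * g y = a * x & B 1 0 * y + B 1 1 * g y = a * f' x].
  move=> y_neq0.
  have : linear_set (graph g) (lspan (y, g y)).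
    exists (y, g y); split=> //; first by apply/mem_graph; exists y.
    by rewrite xpair_eqE (negPf y_neq0).
  case/eqL=> P [u0 [/mem_graph[x ->] x_neq0 ->]] /(_ (y, g y))[+ _].
  case=> [|u /mem_lspan[a ->] [ey eg]]; first by apply/mem_lspan; exists 1; rewrite !mul1r.
  have x0 : x != 0.
    by apply: contraNneq x_neq0 => ->; rewrite linear0.
  exists (s a), (s x); split; rewrite ?fmorph_eq0 //.
  - apply: contraNneq y_neq0 => a0; rewrite ey a0 /= !mul0r rmorph0 !mulr0 addr0 //.
  - by rewrite {1}ey eg B0 rmorphM.
  - by rewrite {1}ey eg B1 rmorphM f's.
have p_neq0 y : y != 0 -> B 0 0 * y + B 0 1 * g y != 0.
  by case/fwd=> a [x [a0 x0 -> _]]; rewrite mulf_neq0.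
split=> //.
pose p := linfun (B 0 0 \*o idfun \+ B 0 1 \*o g).
pose r := linfun (B 1 0 \*o idfun \+ B 1 1 \*o g).
have pE y : p y = B 0 0 * y + B 0 1 * g y by rewrite lfunE.
have rE y : r y = B 1 0 * y + B 1 1 * g y by rewrite lfunE.
have kerp : lker p == 0%VS.
  rewrite -subv0; apply/subvP=> y; rewrite memv_ker memv0 pE.
  by apply: contraTT => /p_neq0.
have hp y : (r \o p^-1)%VF (p y) = r y by rewrite comp_lfunE lker0_lfunK.
exists (r \o p^-1)%VF; split=> [y|m]; first by rewrite -pE -rE hp.
split=> [[x' x'_neq0 f'x'] | [x x_neq0]]; last first.
  have px : p ((p^-1)%VF x) = x by rewrite lker0_lfunVK.
  have y_neq0 : (p^-1)%VF x != 0 by apply: contraNneq x_neq0 => y0; rewrite -px y0 linear0.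
  rewrite -px hp pE rE; have [a [z [a0 z0 -> ->]]] := fwd _ y_neq0 => e.
  by exists z => //; apply: (mulfI a0); rewrite e mulrCA.
(* Conversely, A and s carry the point of (x, f x) to a point of the linear set of g, which the
   inverse of A brings back to (x', f' x'). *)
have [x sx] := rmorph_surj s x'.
pose w := semilinear_map A s (x, f x).
have x_neq0 : x != 0 by apply: contraNneq x'_neq0 => x0; rewrite -sx x0 rmorph0.
have : linear_set (graph g) (lspan w).
  apply/eqL; exists (lspan (x, f x)).
    exists (x, f x); split=> //; first by apply/mem_graph; exists x.
    by rewrite xpair_eqE (negPf x_neq0).
  move=> w'; split=> [/mem_lspan[b ->]|[u /mem_lspan[a ->] ->]].
    have [a <-] := rmorph_surj s b.
    exists (a * x, a * f x); first by apply/mem_lspan; exists a.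
    by congr pair; rewrite /= !rmorphM /=; ring.
  apply/mem_lspan; exists (s a); congr pair; rewrite /= !rmorphM /=; ring.
case=> _ [/mem_graph[y ->] yg_neq0 eqw].
have y_neq0 : y != 0 by apply: contraNneq yg_neq0 => ->; rewrite linear0.
have : (y, g y) \in lspan w.
  by rewrite eqw; apply/mem_lspan; exists 1; rewrite !mul1r.
case/mem_lspan=> b [ey eg].
exists (p y); first by rewrite pE p_neq0.
have e1 : p y = b * x'.
  by rewrite pE {1}ey eg -sx -[s x in RHS](B0 (s x) (s (f x))); ring.
rewrite hp e1 mulrCA -f'x' rE {1}ey eg -sx f's -[s (f x) in RHS](B1 (s x) (s (f x))).
by rewrite /=; ring.
Qed.

End Equivalence.

(** * The conjugate of c when q is 2 or 3 modulo 5 *)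

Section Root.

Variables (F : finFieldType) (L : splittingFieldType F) (c : L).
Hypothesis hc : c ^+ 2 + c = 1.

(* c = z + 1/z for a fifth root of unity z in an extension of L. *)
Lemma qpow1_root_conj :
  #|F| = 2 %[mod 5] \/ #|F| = 3 %[mod 5] -> qpow 1 c = -1 - c.
Proof.
move=> q5; pose F' := (finvect_type L : finFieldType).
pose p : {poly F'} := 'X^2 - c *: 'X + 1.
have szp : size p = 3%N.
  rewrite /p -addrA size_polyDl size_polyXn // (leq_ltn_trans (size_polyD _ _)) //.
  rewrite size_polyN size_poly1 gtn_max /= andbT.
  by rewrite (leq_ltn_trans (size_scale_leq _ _)) ?size_polyX.
have p_neq0 : p != 0 by rewrite -size_poly_eq0 szp.
have [E [rs p_rs _]] := FinSplittingFieldFor p_neq0.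
pose iota := in_alg E : {rmorphism F' -> E}; pose c' : E := iota c.
have hc' : c' ^+ 2 + c' = 1 by rewrite -rmorphXn -rmorphD hc rmorph1.
have [z] : exists z, root (map_poly iota p) z.
  have := eqp_size p_rs; rewrite size_map_poly szp size_prod_XsubC => -[].
  case: rs p_rs => // z rs p_rs _; exists z.
  by rewrite (eqp_root p_rs) root_prod_XsubC mem_head.
rewrite /p rmorphD rmorphB rmorph1 /= map_polyXn map_polyZ map_polyX /root !hornerE.
rewrite -/c' => /eqP z2.
have z_neq0 : z != 0.
  apply: contra_eq_neq z2 => ->.
  by rewrite expr0n mulr0 subrr add0r oner_eq0.
have zc : c' = z + z^-1.
  apply: (mulIf z_neq0); rewrite mulrDl mulVf // -expr2.
  by apply: subr0_eq; rewrite -[RHS]oppr0 -[in RHS]z2; ring.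
(* Modulo the equation of [c'], the two quadratic factors multiply to the fifth cyclotomic
   polynomial. *)
have z5 : z ^+ 5 = 1.
  apply: subr0_eq.
  transitivity ((z - 1) * ((z ^+ 2 - c' * z + 1) * (z ^+ 2 + (1 + c') * z + 1)
     + (c' ^+ 2 + c' - 1) * z ^+ 2)); first by ring.
  by rewrite z2 hc' subrr !mul0r addr0 mulr0.
have cq : c' ^+ #|F| = z ^+ #|F| + z ^- #|F|.
  have [ch ch_pr chF] := finPcharP F.
  have chE : ch \in [pchar E] by rewrite pchar_lalg; rewrite (pchar_lalg L).
  rewrite zc exprDn_pchar ?exprVn // (eq_pnat _ (pcharf_eq chE)).
  by rewrite (card_pprimeChar chF) pnatX pnat_id.
(* z^q is z^2 or z^3 = z^-2, and z^2 + z^-2 is the square of [c'] minus 2. *)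
have c'q : c' ^+ #|F| = -1 - c'.
  have zV2 : z ^+ 2 + z ^- 2 = -1 - c'.
    transitivity ((z + z^-1) ^+ 2 - 2); first by field.
    by rewrite -zc -[c' ^+ 2](addrK c') hc'; ring.
  rewrite cq (divn_eq #|F| 5) exprD mulnC exprM z5 expr1n mul1r.
  rewrite -zV2; case: q5 => -> //; rewrite modn_small // addrC.
  have z3 : z ^+ 3 = z ^- 2.
    by apply: (mulIf (expf_neq0 2 z_neq0)); rewrite -exprD z5 mulVf ?expf_neq0.
  by rewrite z3 invrK.
apply: (fmorph_inj iota); rewrite rmorphB rmorphN1 -/c' -c'q.
by rewrite /qpow expn1 rmorphXn.
Qed.
End Root.

(** * Digits in base q, and power sums over a finite field *)

(* A carry would need more powers of q than the carry-free expansion. *)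
Lemma binary_digits_uniq q n (c d : nat -> nat) : (1 < q)%N ->
    (forall i, d i <= 1)%N ->
    (\sum_(i < n) c i * q ^ i = \sum_(i < n) d i * q ^ i)%N ->
    (\sum_(i < n) c i <= \sum_(i < n) d i)%N ->
  forall i, (i < n)%N -> c i = d i.
Proof.
move=> q_gt1; elim: n c d => [|n IHn] c d d1 //.
have shift (e : nat -> nat) : (\sum_(i < n.+1) e i * q ^ i =
    e 0%N + q * \sum_(i < n) e i.+1 * q ^ i)%N.
  rewrite big_ord_recl expn0 muln1 big_distrr; congr (_ + _)%N.
  by apply: eq_bigr => i _; rewrite expnS mulnCA.
rewrite !shift !big_ord_recl /= => eX le_cd.
(* The lowest digits agree modulo q and [d 0] is less than q, so [c 0] exceeds it by a multiple of
   q, the carry. *)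
have [k ck] : exists k, (c 0 = d 0 + k * q)%N.
  exists (c 0 %/ q)%N; rewrite [LHS](divn_eq _ q) addnC; congr (_ + _)%N.
  move/(congr1 (modn^~ q)): eX; rewrite ![(q * _)%N]mulnC ![(_ + _ * q)%N]addnC.
  by rewrite !modnMDl => ->; rewrite modn_small // (leq_ltn_trans (d1 0%N)).
case: n shift IHn eX le_cd => [|n] _ IHn.
  by move=> eX _ [|//] _; move: eX; rewrite !big_ord0 !muln0 !addn0.
(* The carry enters the next digit as k instead of k q. By induction the new digit sum equals that
   of the shifted [d], while the old one was bounded by that of [d]; so k q <= k. *)
pose c' i := (c i.+1 + (i == 0) * k)%N.
have c'X m : (\sum_(i < n.+1) c' i * m ^ i = k + \sum_(i < n.+1) c i.+1 * m ^ i)%N.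
  rewrite !big_ord_recl /c' /= expn0 !muln1 mul1n addnA [(k + _)%N]addnC.
  by congr (_ + _)%N; apply: eq_bigr => i _; rewrite mul0n addn0.
have c'1 : (\sum_(i < n.+1) c' i = k + \sum_(i < n.+1) c i.+1)%N.
  rewrite !big_ord_recl /c' /= mul1n addnA [(k + _)%N]addnC.
  by congr (_ + _)%N; apply: eq_bigr => i _; rewrite mul0n addn0.
move=> eX le_cd.
have eX' : (\sum_(i < n.+1) c' i * q ^ i = \sum_(i < n.+1) d i.+1 * q ^ i)%N.
  rewrite c'X; apply/eqP; rewrite -(eqn_pmul2l (ltnW q_gt1)) -(eqn_add2l (d 0%N)).
  by rewrite mulnDr addnA (mulnC q) -ck eX.
have le_k : (k <= k * q)%N by rewrite leq_pmulr // ltnW.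
have le' : (\sum_(i < n.+1) c' i <= \sum_(i < n.+1) d i.+1)%N.
  rewrite c'1; move: ck le_k le_cd.
  by move: (_ * _)%N (\sum_(i < _) _)%N (\sum_(i < _) _)%N; lia.
have eq_c' := IHn _ _ (fun i => d1 i.+1) eX' le'.
have k0 : k = 0%N.
  have eq_sum : (\sum_(i < n.+1) c' i = \sum_(i < n.+1) d i.+1)%N.
    by apply: eq_bigr => i _; apply: eq_c'.
  have [//|k_gt0] := posnP k.
  have lt_k : (k < k * q)%N by rewrite ltn_Pmulr.
  move: c'1 eq_sum ck le_cd lt_k.
  move: (k * q)%N (\sum_(i < _) _)%N (\sum_(i < _) _)%N (\sum_(i < _) _)%N; lia.
case=> [_|i]; first by rewrite ck k0 addn0.
by rewrite ltnS => /eq_c'; rewrite /c' k0 muln0 addn0.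
Qed.

Lemma sum_ord6 (V : nmodType) (g : nat -> V) :
  \sum_(i < 6) g i = g 0 + g 1 + g 2 + g 3 + g 4 + g 5.
Proof. by rewrite !big_ord_recr big_ord0 /= add0r. Qed.

Lemma card_natr0 (E : finFieldType) : #|E|%:R = 0 :> E.
Proof. by rewrite -[_%:R]FinRing.zmodXgE -cardsT (expg_cardG (in_setT _)). Qed.

(** If g^n <> 1 for some nonzero g, the substitution of x g for x multiplies the sum by g^n, so it
    vanishes. If all n-th powers are 1, it is the number of terms, which is -1 in E. *)
Lemma sum_expf (E : finFieldType) n : (0 < n)%N ->
  \sum_(x : E | x != 0) x ^+ n = - (#|E|.-1 %| n)%:R.
Proof.
move=> n_gt0; have E_gt1 := finNzRing_gt1 E.
have expE (x : E) : x != 0 -> x ^+ #|E|.-1 = 1.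
  by move=> x0; apply: (mulfI x0); rewrite -exprS prednK ?expf_card ?mulr1 // ltnW.
have [/dvdnP[k ->]|ndv] := boolP (_ %| _)%N.
  rewrite (eq_bigr (fun=> 1)) => [|x x0]; last by rewrite mulnC exprM expE ?expr1n.
  rewrite sumr_const.
  have -> : #|[pred x : E | x != 0]| = #|E|.-1.
    by rewrite -(cardC1 (0 : E)); apply: eq_card => x; rewrite !inE.
  apply/eqP; rewrite -subr_eq0 opprK -mulrSr prednK ?(ltnW E_gt1) //.
  by rewrite card_natr0.
(* Otherwise X^r - 1, with 0 < r < [#|E|.-1], would have [#|E|.-1] roots. *)
have [g g0 gn] : exists2 g : E, g != 0 & g ^+ n != 1.
  have [g /andP[g0 gn]|all1] := pickP (fun g : E => (g != 0) && (g ^+ n != 1)).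
    by exists g.
  pose r := (n %% #|E|.-1)%N.
  have E1_gt0 : (0 < #|E|.-1)%N by rewrite -ltnS prednK // ltnW.
  have r_gt0 : (0 < r)%N by rewrite lt0n; apply: contra ndv.
  have X_neq0 : 'X^r - 1 != 0 :> {poly E} by rewrite -size_poly_eq0 size_XnsubC.
  have roots : all (root ('X^r - 1)) (enum (predC1 (0 : E))).
    apply/allP=> x; rewrite mem_enum !inE => x0.
    have /negbT := all1 x; rewrite x0 negbK => /eqP xn.
    rewrite rootE !hornerE subr_eq0 -xn [in X in _ == X](divn_eq n #|E|.-1) exprD mulnC exprM.
    by rewrite expE // expr1n mul1r.
  have := max_poly_roots X_neq0 roots (enum_uniq _).
  by rewrite -cardE cardC1 size_XnsubC // ltnS leqNgt ltn_mod E1_gt0.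
apply: (mulIf (x := g ^+ n - 1)); rewrite ?subr_eq0 // oppr0 mul0r mulrBr mulr1.
apply/eqP; rewrite subr_eq0; apply/eqP.
rewrite [RHS](reindex_inj (mulIf g0)) big_distrl /=.
apply: eq_big => [x|x _]; last by rewrite exprMn.
by rewrite mulf_eq0 (negPf g0) orbF.
Qed.

(** * Moments of the ratios h(x) / x *)

Section Moments.

Variables (F : finFieldType) (L : splittingFieldType F).
Hypothesis dimL : \dim {:L} = 6%N.
Local Notation q := #|F|.
Local Notation E := (finvect_type L).

(** A ratio m is attained exactly on the nonzero vectors of the kernel of f - m, whose number q^k -
    1 is -1 in L. Each side is thus minus the sum of [phi] over the distinct ratios. *)
Lemma same_ratio_sum (f h : {linear L -> L}) (phi : L -> L) :
    (forall m, (exists2 x, x != 0 & f x = m * x) <->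
               (exists2 x, x != 0 & h x = m * x)) ->
  \sum_(x : E | x != 0) phi (f x / x) = \sum_(x : E | x != 0) phi (h x / x).
Proof.
have cnt (g : {linear L -> L}) : \sum_(x : E | x != 0) phi (g x / x) =
    \sum_(m : E) phi m *- [exists x : E, (x != 0) && (g x == m * x :> L)].
  pose ratio : E -> E := fun x => g x / x : L.
  rewrite (partition_big ratio predT) //=.
  apply: eq_bigr => m _; rewrite (eq_bigr (fun=> phi m)); last first.
    by move=> x /andP[_ /eqP rx]; rewrite -rx.
  rewrite sumr_const; set N := #|_|.
  have [/existsP[x /andP[x0 /eqP gx]]|/existsPn noneq] :=
    boolP [exists x : E, (x != 0) && (g x == m * x :> L)].
    pose V := lker (linfun (g \- m \*o idfun)).
    have memV (y : L) : (y \in V) = (g y == m * y).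
      by rewrite memv_ker lfunE /= subr_eq0.
    have cardV : #|(V : {pred E})| = N.+1.
      rewrite (cardD1 (0 : E)) memV linear0 mulr0 eqxx add1n; congr _.+1.
      apply: eq_card => y; rewrite !inE.
      transitivity ((y != 0) && (ratio y == m)); last by [].
      case: (eqVneq y 0) => //= y0.
      by rewrite [y \in _]memV [RHS](can2_eq (divfK y0) (mulfK y0)).
    have dimV : (0 < \dim V)%N.
      rewrite lt0n dimv_eq0; apply: contraNneq x0 => V0.
      by rewrite -memv0 -V0 memV gx.
    apply/eqP; rewrite -subr_eq0 opprK -mulrSr -cardV card_vspace.
    rewrite -mulr_natr natrX; have -> : #|F|%:R = 0 :> L.
      by rewrite -(rmorph_nat (in_alg L)) card_natr0 rmorph0.
    by rewrite expr0n eqn0Ngt dimV mulr0.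
  suff -> : N = 0%N by rewrite oppr0.
  apply: eq_card0 => x; rewrite !inE; apply/negP=> /andP[x0 /eqP gx].
  by case/negP: (noneq x); rewrite x0 -gx divfK /=.
move=> fh; rewrite !cnt; apply: eq_bigr => m _; congr (- (_ *+ nat_of_bool _)).
apply/existsP/existsP=> -[x /andP[x0 /eqP e]].
  have [|y y0 ey] := (fh m).1; first by exists x.
  by exists y; rewrite y0 ey eqxx.
have [|y y0 ey] := (fh m).2; first by exists x.
by exists y; rewrite y0 ey eqxx.
Qed.

Definition monomial (s : seq nat) (x : L) := \prod_(i <- s) qpow i x.

Lemma monomialE s x : monomial s x = x ^+ (\sum_(i <- s) q ^ i).
Proof. by rewrite expr_sum. Qed.

Lemma monomial_mod6 s x : monomial s x = monomial [seq i %% 6 | i <- s]%N x.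
Proof.
by rewrite /monomial big_map; apply: eq_bigr => i _; apply: qpow_modn.
Qed.

(** Both weights are sums of at most q powers of q, each at most q^5, so they differ by less than
    q^6 - 1 and the power sum vanishes unless they agree. As t has no repeated index, uniqueness of
    digits then makes s, reduced modulo 6, a permutation of t. *)
Lemma sum_monomial_ratio s t : size s = size t -> uniq t -> all (gtn 6) t ->
    (size t <= q)%N ->
  \sum_(x : E | x != 0) monomial s x / monomial t x =
    - (perm_eq [seq i %% 6 | i <- s]%N t)%:R.
Proof.
move=> szs ut t6 tq; have q_gt1 := finNzRing_gt1 F.
under eq_bigr do rewrite monomial_mod6; set s' := map _ s.
have s'6 : all (gtn 6) s' by apply/allP=> _ /mapP[i _ ->]; rewrite /= ltn_mod.
have {}szs : size s' = size t by rewrite size_map.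
move: s' s'6 szs => {}s s6 szs.
pose wt u := (\sum_(i <- u) q ^ i)%N.
have wt_bounds u : all (gtn 6) u -> (size u <= wt u <= size u * q ^ 5)%N.
  rewrite /wt; elim: u => [|i u IHu] /=; first by rewrite big_nil.
  case/andP=> i6 /IHu /andP[lo hi]; rewrite big_cons mulSn -add1n.
  by rewrite !leq_add // ?expn_gt0 ?(ltnW q_gt1) // leq_exp2l.
have wt_le u v : all (gtn 6) u -> all (gtn 6) v -> size u = size t ->
    size v = size t -> (wt u < wt v + (q ^ 6).-1)%N.
  move=> /wt_bounds/andP[_ hu] /wt_bounds/andP[lv _] su sv.
  rewrite su in hu; rewrite sv in lv; apply: leq_ltn_trans hu _.
  have : (size t * (q ^ 5).-1 <= q * (q ^ 5).-1)%N by rewrite leq_mul2r tq orbT.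
  rewrite (expnS q 5); have : (0 < q ^ 5)%N by rewrite expn_gt0 ltnW.
  case: (q ^ 5)%N => // m _; rewrite !mulnS /=.
  by move: lv q_gt1; move: (size t * m)%N (q * m)%N (wt v) (size t) q; clear; lia.
have := wt_le s t s6 t6 szs erefl; have := wt_le t s t6 s6 erefl szs.
set Q := (q ^ 6).-1 => lt_ts lt_st.
under eq_bigr => x x0.
  rewrite !monomialE -/(wt s) -/(wt t).
  (* Adding Q = q^6 - 1 keeps the exponent strictly between 0 and 2 Q. *)
  have -> : x ^+ wt s / x ^+ wt t = x ^+ (wt s + Q - wt t)%N :> L.
    have xt0 : x ^+ wt t != 0 :> L by rewrite expf_neq0.
    apply: (mulIf xt0); rewrite divfK //.
    rewrite -exprD subnK; last by rewrite ltnW.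
    rewrite exprD -[LHS]mulr1; congr (_ * _).
    have : x ^+ Q.+1 = x.
      rewrite prednK ?expn_gt0 ?(ltnW q_gt1) // -(card_degree6 dimL).
      exact: (expf_card (x : E)).
    by rewrite exprS -[in X in _ = X](mulr1 x) => /(mulfI x0) ->.
over.
rewrite (sum_expf E) ?subn_gt0 // (card_degree6 dimL) -/Q; congr (- (nat_of_bool _)%:R).
have dvdE : (Q %| wt s + Q - wt t)%N = (wt s == wt t).
  apply/idP/eqP=> [/dvdnP[[|[|k]]]|->]; last by rewrite addKn.
  - by move: lt_ts; clear; move: (wt s) (wt t); lia.
  - by move: lt_ts; clear; move: (wt s) (wt t); lia.
  - by rewrite !mulSn; move: lt_st lt_ts; clear; move: (k * Q)%N (wt s) (wt t); lia.
rewrite dvdE.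
have sum_count (G : nat -> nat) u : all (gtn 6) u ->
    (\sum_(i <- u) G i = \sum_(i < 6) count_mem (i : nat) u * G i)%N.
  elim: u => [|k u IHu] /=; first by rewrite big_nil big1.
  case/andP=> k6 /IHu IH; rewrite big_cons IH.
  under [RHS]eq_bigr do rewrite mulnDl.
  rewrite big_split /=; congr (_ + _)%N.
  rewrite (bigD1 (Ordinal k6)) //= eqxx mul1n big1 ?addn0 // => i.
  by rewrite -val_eqE /= eq_sym => /negPf->.
apply/eqP/idP=> [e|e]; last by rewrite /wt (perm_big _ e).
have cnt : forall i, (i < 6)%N -> count_mem i s = count_mem i t.
  apply: (@binary_digits_uniq q 6 (fun i => count_mem i s) (fun i => count_mem i t)) => //.
  - by move=> i; rewrite count_uniq_mem // leq_b1.
  - by rewrite -!sum_count.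
  - have size_count u : all (gtn 6) u ->
        (\sum_(i < 6) count_mem (i : nat) u = size u)%N.
      move/(sum_count (fun=> 1%N)); rewrite sum1_size => ->.
      by apply: eq_bigr => i _; rewrite muln1.
    by rewrite !size_count // szs.
rewrite /perm_eq; apply/allP=> x; rewrite mem_cat => x_st /=; apply/eqP/cnt.
by case/orP: x_st => [/(allP s6)|/(allP t6)].
Qed.

Variable a : nat -> L.
Let h (x : L) := \sum_(i < 6) a i * qpow i x.

(* Expands the factors qpow e (h x), e in u, of the moment of exponent           *)
(* sum_(e in t) q^e, accumulating in s the indices of the monomials chosen.      *)
Fixpoint moment_coef t u s : L :=
  if u is e :: u' then
    let term i := qpow e (a i) * moment_coef t u' ((e + i)%N :: s) in
    term 0 + term 1 + term 2 + term 3 + term 4 + term 5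
  else - (perm_eq [seq i %% 6 | i <- s]%N t)%:R.

Lemma moment_coefP t u s : (size u + size s = size t)%N -> uniq t ->
    all (gtn 6) t -> (size t <= q)%N ->
  \sum_(x : E | x != 0) (\prod_(e <- u) qpow e (h x)) * monomial s x / monomial t x =
    moment_coef t u s.
Proof.
elim: u s => [|e u IHu] s /= sz ut t6 tq.
  rewrite -sum_monomial_ratio //.
  by apply: eq_bigr => x _; rewrite big_nil mul1r.
under eq_bigr => x _.
  rewrite big_cons {1}/h rmorph_sum /= 3!big_distrl /=.
over.
rewrite exchange_big /= -(sum_ord6 (fun i => qpow e (a i) * moment_coef t u ((e + i)%N :: s))).
apply: eq_bigr => i _ /=.
rewrite -IHu ?big_distrr //=; last by rewrite addnS -addSn.
apply: eq_bigr => x _; rewrite rmorphM /= qpow_qpow /monomial big_cons.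
ring.
Qed.

(** For a concrete t, [moment_coef] computes to a polynomial in conjugates of the coefficients of
    h. *)
Lemma moments t : uniq t -> all (gtn 6) t -> (size t <= q)%N ->
  \sum_(x : E | x != 0) \prod_(e <- t) qpow e (h x / x) = moment_coef t t [::].
Proof.
move=> ut t6 tq; rewrite -moment_coefP ?addn0 //; apply: eq_bigr => x _.
rewrite /monomial big_nil mulr1 -prodfV -big_split; apply: eq_bigr => e _ /=.
by rewrite fmorph_div.
Qed.

End Moments.

(** * Coefficients of h, and the functional equation *)

Section Inequivalence.

Variables (F : finFieldType) (L : splittingFieldType F).
Hypotheses (dimL : \dim {:L} = 6%N) (q_ge3 : (3 <= #|F|)%N).
Hypothesis char2 : 2%:R != 0 :> L.

Lemma qpoly6_eq0 (c0 c1 c2 c3 c4 c5 : L) :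
    (forall y, c0 * y + c1 * qpow 1 y + c2 * qpow 2 y + c3 * qpow 3 y
       + c4 * qpow 4 y + c5 * qpow 5 y = 0) ->
  [/\ c1 = 0, c2 = 0, c3 = 0, c4 = 0 & c5 = 0].
Proof.
move=> e; pose a i := [:: c0; c1; c2; c3; c4; c5]`_i.
have a0 i : (i < 6)%N -> a i = 0.
  move=> i6; apply: (qpoly_eq0 dimL (a := fun i => a i) _ (Ordinal i6)) => x.
  by rewrite (sum_ord6 (fun i => a i * qpow i x)) /a /= qpow0 e.
by split; [apply: (a0 1%N)|apply: (a0 2%N)|apply: (a0 3%N)|apply: (a0 4%N)|apply: (a0 5%N)].
Qed.

Variable c : L.
Hypotheses (hc : c ^+ 2 + c = 1) (qc : qpow 1 c = -1 - c).

Lemma same_ratio_coefs (h : 'End(L)) :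
    (forall m, (exists2 x, x != 0 & qpow 1 x + qpow 3 x + c * qpow 5 x = m * x) <->
               (exists2 x, x != 0 & h x = m * x)) ->
  exists a1 a3 a5 : L,
    [/\ forall x, h x = a1 * qpow 1 x + a3 * qpow 3 x + a5 * qpow 5 x,
        a1 * qpow 1 a5 = -1 - c & a3 * qpow 3 a3 = 1].
Proof.
move=> fh; have [a' a'E] := qpoly_of_lfun dimL h.
pose a i := a' (inord i); pose b i := [:: 0; 1; 0; 1; 0; c]`_i.
have hE x : h x = \sum_(i < 6) a i * qpow i x.
  by rewrite a'E; apply: eq_bigr => i _; rewrite /a inord_val.
have fE x : (qpow 1 \+ qpow 3 \+ c \*o qpow 5) x = \sum_(i < 6) b i * qpow i x.
  by rewrite (sum_ord6 (fun i => b i * qpow i x)) /b /= !mul0r !mul1r add0r !addr0.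
have moment_eq t : uniq t -> all (gtn 6) t -> (size t <= 3)%N ->
    moment_coef b t t [::] = moment_coef a t t [::].
  move=> ut t6 t3; have tq := leq_trans t3 q_ge3.
  rewrite -!(moments dimL) //.
  under eq_bigr do rewrite -fE.
  under [RHS]eq_bigr do rewrite -hE.
  exact: (@same_ratio_sum F L (qpow 1 \+ qpow 3 \+ c \*o qpow 5) h
                          (fun r => \prod_(e <- t) qpow e r) fh).
have simp := (rmorph0, rmorph1, mul0r, mulr0, addr0, add0r, oppr0, mulrN, mulr1, mul1r).
have a0 : a 0%N = 0.
  have := moment_eq [:: 0]%N isT isT isT; rewrite /= /b /= !simp qpow0.
  by move/esym/eqP; rewrite oppr_eq0 => /eqP.
(* With a_0 = 0, minus these moments are a_1 (a_5)_1, a_2 (a_4)_2, a_3 (a_3)_3 and a_1 (a_1)_1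
   (a_4)_2 + a_2 (a_5)_1 (a_5)_2. For f the second and the fourth vanish, and a_1, a_5 are nonzero
   by the first; so a_2 = a_4 = 0. *)
have m1 := moment_eq [:: 0; 1]%N isT isT isT.
have m2 := moment_eq [:: 0; 2]%N isT isT isT.
have m3 := moment_eq [:: 0; 3]%N isT isT isT.
have m4 := moment_eq [:: 0; 1; 2]%N isT isT isT.
move: m1 m2 m3 m4; rewrite /= a0 /b /= !simp !qpow0.
move=> /oppr_inj m1 /esym/eqP m2 /oppr_inj m3 m4.
have conj_neq0 : -1 - c != 0.
  by rewrite -qc fmorph_eq0 (golden_neq0 hc).
have a1a5 : a 1%N * qpow 1 (a 5%N) != 0 by rewrite -m1 qc.
have [a1_neq0 a5_neq0] : a 1%N != 0 /\ a 5%N != 0.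
  by apply/andP; move: a1a5; rewrite mulf_eq0 fmorph_eq0 negb_or.
have [a2 a4] : a 2%N = 0 /\ a 4%N = 0.
  move: m2 m4; rewrite oppr_eq0 mulf_eq0 fmorph_eq0 => /orP[]/eqP->.
    rewrite !simp => /esym/eqP.
    by rewrite oppr_eq0 !mulf_eq0 !fmorph_eq0 (negPf a1_neq0) /= => /eqP.
  rewrite !simp => /esym/eqP.
  by rewrite oppr_eq0 !mulf_eq0 !fmorph_eq0 (negPf a5_neq0) /= !orbF => /eqP.
exists (a 1%N), (a 3%N), (a 5%N); split; rewrite -?m1 ?qc -?m3 // => x.
by rewrite hE (sum_ord6 (fun i => a i * qpow i x)) a0 a2 a4 !mul0r add0r !addr0.
Qed.

Variables (h : 'End(L)) (a1 a3 a5 e1 e2 e4 e5 al be ga de : L).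
Hypothesis hE : forall x, h x = a1 * qpow 1 x + a3 * qpow 3 x + a5 * qpow 5 x.
Hypotheses (a15 : a1 * qpow 1 a5 = -1 - c) (a33 : a3 * qpow 3 a3 = 1).
(** The common shape of the known families: no index divisible by 3 occurs. *)
Let g (y : L) := e1 * qpow 1 y + e2 * qpow 2 y + e4 * qpow 4 y + e5 * qpow 5 y.
Hypothesis p_neq0 : forall y, y != 0 -> al * y + be * g y != 0.
Hypothesis hp : forall y, h (al * y + be * g y) = ga * y + de * g y.

Let a15_neq0 : a1 != 0 /\ a5 != 0.
Proof.
apply/andP; rewrite -negb_or -(fmorph_eq0 (qpow 1) a5) -mulf_eq0 a15 -qc fmorph_eq0.
exact: golden_neq0 hc.
Qed.

Let a3_neq0 : a3 != 0.
Proof. by apply: contra_eq_neq a33 => ->; rewrite mul0r eq_sym oner_neq0. Qed.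

(** These compare the coefficients of y_1 to y_5 in [hp], in this order. *)
Lemma qpoly_coefs :
  [/\ a1 * qpow 1 al + a3 * qpow 3 (be * e4) + a5 * qpow 5 (be * e2) = de * e1,
      a1 * qpow 1 (be * e1) + a3 * qpow 3 (be * e5) = de * e2,
      a3 * qpow 3 al + a1 * qpow 1 (be * e2) + a5 * qpow 5 (be * e4) = 0,
      a3 * qpow 3 (be * e1) + a5 * qpow 5 (be * e5) = de * e4
    & a5 * qpow 5 al + a1 * qpow 1 (be * e4) + a3 * qpow 3 (be * e2) = de * e5].
Proof.
have pE y : al * y + be * g y = al * y + be * e1 * qpow 1 y + be * e2 * qpow 2 y
    + be * e4 * qpow 4 y + be * e5 * qpow 5 y by rewrite /g; ring.
have qpowE k i (y : L) : qpow k (qpow i y) = qpow ((k + i) %% 6) y.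
  by rewrite qpow_qpow qpow_modn.
have [|c1 c2 c3 c4 c5] := @qpoly6_eq0
  (a1 * qpow 1 (be * e5) + a5 * qpow 5 (be * e1) - ga)
  (a1 * qpow 1 al + a3 * qpow 3 (be * e4) + a5 * qpow 5 (be * e2) - de * e1)
  (a1 * qpow 1 (be * e1) + a3 * qpow 3 (be * e5) - de * e2)
  (a3 * qpow 3 al + a1 * qpow 1 (be * e2) + a5 * qpow 5 (be * e4))
  (a3 * qpow 3 (be * e1) + a5 * qpow 5 (be * e5) - de * e4)
  (a5 * qpow 5 al + a1 * qpow 1 (be * e4) + a3 * qpow 3 (be * e2) - de * e5).
  move=> y; have /eqP := hp y; rewrite -subr_eq0 pE hE => /eqP <-.
  move: (be * e1) (be * e2) (be * e4) (be * e5) => b1 b2 b4 b5.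
  rewrite !rmorphD !rmorphM /= !qpowE /= !qpow0 /g; ring.
by split=> //; apply: subr0_eq.
Qed.

Let scalars_neq0 : al = 0 -> be = 0 -> False.
Proof.
move=> al0 be0; have := p_neq0 (oner_neq0 _).
by rewrite al0 be0 !mul0r addr0 eqxx.
Qed.

(** The coefficient of y_2 forces be = 0, and then that of y_3 forces al = 0, against [p_neq0]. *)
Lemma no_support_1_4 : e2 = 0 -> e5 = 0 -> e1 != 0 -> False.
Proof.
move=> e20 e50 e1_neq0; have [_ + + _ _] := qpoly_coefs.
rewrite e20 e50 !mulr0 !rmorph0 !mulr0 !addr0 => /eqP.
rewrite mulf_eq0 (negPf a15_neq0.1) fmorph_eq0 mulf_eq0 (negPf e1_neq0) orbF => /eqP be0.
rewrite be0 mul0r rmorph0 mulr0 addr0 => /eqP.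
rewrite mulf_eq0 (negPf a3_neq0) fmorph_eq0 => /eqP al0.
exact: scalars_neq0.
Qed.

(** Here the coefficient of y_4 forces be = 0, and that of y_3 again al = 0. *)
Lemma no_support_2_5 : e1 = 0 -> e4 = 0 -> e5 != 0 -> False.
Proof.
move=> e10 e40 e5_neq0; have [_ _ + + _] := qpoly_coefs.
rewrite e10 e40 !mulr0 !rmorph0 !mulr0 !addr0 add0r => + /eqP.
rewrite mulf_eq0 (negPf a15_neq0.2) fmorph_eq0 mulf_eq0 (negPf e5_neq0) orbF => + /eqP be0.
rewrite be0 mul0r rmorph0 mulr0 addr0 => /eqP.
rewrite mulf_eq0 (negPf a3_neq0) fmorph_eq0 => /eqP al0.
exact: scalars_neq0.
Qed.

(** The coefficient of y_3 gives al = 0. With P = be e1 and Q = be e5, those of y_2, conjugated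
    twice, and of y_4 are linear equations in P_3 and Q_5, whose determinant must vanish: this is
    [key]. Multiplying [key] by its third conjugate gives 1 = c c', whereas c c' = -1. *)
Lemma no_support_1_5 : e2 = 0 -> e4 = 0 -> (e1 != 0) || (e5 != 0) -> False.
Proof.
move=> e20 e40 e15_neq0; have [c1 c2 c3 c4 _] := qpoly_coefs.
rewrite e20 e40 !mulr0 !rmorph0 !mulr0 !addr0 in c1 c2 c3 c4.
have al0 : al = 0.
  by move/eqP: c3; rewrite mulf_eq0 (negPf a3_neq0) fmorph_eq0 => /eqP.
have be_neq0 : be != 0 by apply/eqP; apply: scalars_neq0.
set P := be * e1 in c2 c4; set Q := be * e5 in c2 c4.
have c2' : a1 * qpow 1 P = - (a3 * qpow 3 Q) by apply/eqP; rewrite -addr_eq0 c2.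
have c4' : a3 * qpow 3 P = - (a5 * qpow 5 Q) by apply/eqP; rewrite -addr_eq0 c4.
have PQ : (P == 0) = (Q == 0).
  by rewrite -(fmorph_eq0 (qpow 1) P) -(mulrI_eq0 _ (lregP a15_neq0.1)) c2'
    oppr_eq0 mulf_eq0 (negPf a3_neq0) fmorph_eq0.
have Q_neq0 : Q != 0.
  by move: e15_neq0 PQ; rewrite !mulf_eq0 (negPf be_neq0) /= => /orP[] /negPf-> // <-.
have P_neq0 : P != 0 by rewrite PQ.
have key : a3 * qpow 2 a3 = a5 * qpow 2 a1.
  have c2'' : qpow 2 a1 * qpow 3 P = - (qpow 2 a3 * qpow 5 Q).
    by have := congr1 (qpow 2) c2'; rewrite rmorphN !rmorphM /= !qpow_qpow.
  apply: (mulIf (x := qpow 3 P * qpow 5 Q)); first by rewrite mulf_neq0 ?fmorph_eq0.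
  transitivity ((a3 * qpow 3 P) * (qpow 2 a3 * qpow 5 Q)); first by ring.
  have c2o : qpow 2 a3 * qpow 5 Q = - (qpow 2 a1 * qpow 3 P) by rewrite c2'' opprK.
  by rewrite c4' c2o; ring.
have qc2 : qpow 2 c = c.
  by rewrite -(qpow_qpow 1 1) qc rmorphB rmorphN1 /= qc; ring.
have a33_2 : qpow 2 a3 * qpow 5 a3 = 1.
  by have := congr1 (qpow 2) a33; rewrite rmorphM /= qpow_qpow rmorph1.
have a15_2 : qpow 2 a1 * qpow 3 a5 = -1 - c.
  by have := congr1 (qpow 2) a15; rewrite rmorphM /= qpow_qpow rmorphB rmorphN1 /= qc2.
have a15_5 : qpow 5 a1 * a5 = c.
  have := congr1 (qpow 5) a15; rewrite rmorphM /= qpow_qpow qpow6 // => ->.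
  by rewrite rmorphB rmorphN1 /= -(qpow_qpow 1 4) -(qpow_qpow 2 2) !qc2 qc; ring.
have : a3 * qpow 2 a3 * qpow 3 (a3 * qpow 2 a3) =
       a5 * qpow 2 a1 * qpow 3 (a5 * qpow 2 a1) by rewrite key.
rewrite !rmorphM /= !qpow_qpow => e.
case/eqP: char2; transitivity ((a3 * qpow 3 a3) * (qpow 2 a3 * qpow 5 a3) + 1).
  by rewrite a33 a33_2 mulr1.
have -> : a3 * qpow 3 a3 * (qpow 2 a3 * qpow 5 a3) =
    (qpow 2 a1 * qpow 3 a5) * (qpow 5 a1 * a5).
  transitivity (a3 * qpow 2 a3 * (qpow 3 a3 * qpow 5 a3)); first by ring.
  by rewrite e; ring.
rewrite a15_2 a15_5; transitivity (1 - (c ^+ 2 + c)); first by ring.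
by rewrite hc subrr.
Qed.

End Inequivalence.

(** * Inequivalence to each family, and the theorem *)

Lemma natr2_eq0_even_card (F : finFieldType) : (2%:R == 0 :> F) = ~~ odd #|F|.
Proof.
have [p p_pr pF] := finPcharP F.
rewrite -(dvdn_pcharf pF) -dvdn2.
have /(congr1 (dvdn 2)) := card_pprimeChar pF.
have n_gt0 : (0 < logn p #|F|)%N.
  have := finNzRing_gt1 F; rewrite {1}(card_pprimeChar pF).
  by case: (logn _ _).
rewrite Euclid_dvdX // n_gt0 andbT => ->.
by rewrite !dvdn_prime2 // eq_sym.
Qed.

(** The support {1, 5} serves the first two families, {1, 4} and {2, 5} the third. The field
    automorphism s replaces c by [s c], a root of the same quadratic, to which the preceding results
    apply. *)
Lemma inequivalent (F : finFieldType) (L : splittingFieldType F) (c : L)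
    (g : {linear L -> L}) (e1 e2 e4 e5 : L) :
    \dim {:L} = 6%N -> c ^+ 2 + c = 1 -> odd #|F| ->
    #|F| = 2 %[mod 5] \/ #|F| = 3 %[mod 5] ->
    (forall y, g y = e1 * qpow 1 y + e2 * qpow 2 y + e4 * qpow 4 y + e5 * qpow 5 y) ->
    [\/ [/\ e2 = 0, e4 = 0 & (e1 != 0) || (e5 != 0)],
        [/\ e2 = 0, e5 = 0 & e1 != 0]
      | [/\ e1 = 0, e4 = 0 & e5 != 0]] ->
  ~ PGammaL_equivalent
      (linear_set (graph (qpow 1 \+ qpow 3 \+ c \*o qpow 5 : L -> L)))
      (linear_set (graph g)).
Proof.
move=> dimL hc oddq q5 gE supp [A [s [uA eqL]]].
have hsc : s c ^+ 2 + s c = 1 by rewrite -rmorphXn -rmorphD hc rmorph1.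
have q_ge3 : (3 <= #|F|)%N.
  by have := finNzRing_gt1 F; move: oddq; case: #|F| => [|[|[]]].
have char2 : 2%:R != 0 :> L.
  by rewrite -(rmorph_nat (in_alg L)) fmorph_eq0 natr2_eq0_even_card oddq.
have sq i x : s (qpow i x) = qpow i (s x) by rewrite /qpow rmorphXn.
have qsc := qpow1_root_conj hsc q5.
have fs x : (qpow 1 \+ qpow 3 \+ s c \*o qpow 5) (s x) =
    s ((qpow 1 \+ qpow 3 \+ c \*o qpow 5) x).
  by rewrite /= !rmorphD rmorphM /= !sq.
have [al [be [ga [de [p0 [h [hp fh]]]]]]] := PGammaL_same_ratios uA fs eqL.
have [a1 [a3 [a5 [hE a15 a33]]]] := same_ratio_coefs dimL q_ge3 hsc qsc fh.
have p0' y : y != 0 -> al * y + be * (e1 * qpow 1 y + e2 * qpow 2 y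
    + e4 * qpow 4 y + e5 * qpow 5 y) != 0 by rewrite -gE; apply: p0.
have hp' y : h (al * y + be * (e1 * qpow 1 y + e2 * qpow 2 y + e4 * qpow 4 y
    + e5 * qpow 5 y)) = ga * y + de * (e1 * qpow 1 y + e2 * qpow 2 y
    + e4 * qpow 4 y + e5 * qpow 5 y) by rewrite -gE; apply: hp.
case: supp => -[].
- exact: (no_support_1_5 dimL char2 hsc qsc hE a15 a33 p0' hp').
- exact: (no_support_1_4 dimL hsc qsc hE a15 a33 p0' hp').
- exact: (no_support_2_5 dimL hsc qsc hE a15 a33 p0' hp').
Qed.

Theorem theorem5p1 (q : nat) (F : finFieldType) (L : splittingFieldType F)
    (cardF : #|F| = q) (dimL : \dim {:L} = 6%N)
    (K : {subfield L}) (dimK : \dim K = 3%N)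
    (c : L) (hc : c ^+ 2 + c = 1) :
  let U := graph (qpow 1 \+ qpow 3 \+ c \*o qpow 5 : L -> L) in
  [/\ \dim U = 6%N,
      scattered U <-> odd q
    & odd q -> q = 2 %[mod 5] \/ q = 3 %[mod 5] ->
      [/\ forall s : nat, coprime s 6 ->
            ~ PGammaL_equivalent (linear_set U)
                (linear_set (graph (qpow s : L -> L))),
          forall (s : nat) (d : L), (s < 6)%N -> coprime s 6 ->
            galNorm 1%VS {:L} d \notin [:: 0; 1] ->
            ~ PGammaL_equivalent (linear_set U)
                (linear_set (graph (d \*o qpow s \+ qpow (6 - s)%N : L -> L)))
        & forall (s : nat) (d : L), coprime s 3 ->
            galNorm K {:L} d \notin [:: 0; 1] ->
            let V := graph (d \*o qpow s \+ qpow (s + 3)%N : L -> L) in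
            scattered V ->
            ~ PGammaL_equivalent (linear_set U) (linear_set V)]].
Proof.
move=> U.
have char2 : (2%:R == 0 :> L) = ~~ odd q.
  by rewrite -(rmorph_nat (in_alg L)) fmorph_eq0 natr2_eq0_even_card cardF.
split; first exact: dim_graph.
  split=> [scat|odd_q].
    apply/negPn/negP; rewrite -char2 => /eqP char2'.
    exact: (not_scattered_char2 dimL dimK hc char2').
  apply: scattered_graph => x y; apply: collinear_same_ratio => //.
  by rewrite char2 odd_q.
move=> odd_q q5; rewrite -cardF in odd_q q5.
have norm_neq0 (M : {vspace L}) d : galNorm M {:L} d \notin [:: 0; 1] -> d != 0.
  by rewrite inE negb_or galNorm_eq0 => /andP[].
have ineq g e1 e2 e4 e5 gE :=
  @inequivalent F L c g e1 e2 e4 e5 dimL hc odd_q q5 gE.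
split=> [s|s d|s d].
(* Only s modulo 6 matters; the residues prime to 6 are 1 and 5. *)
- rewrite -coprime_modl.
  have gE y := qpow_modn dimL s y.
  have : (s %% 6 < 6)%N by rewrite ltn_mod.
  case: (s %% 6)%N gE => [|[|[|[|[|[|]]]]]] // gE _ _.
  + apply: (ineq _ 1 0 0 0) => [y|]; first by rewrite /= gE; ring.
    by constructor 1; rewrite oner_neq0.
  + apply: (ineq _ 0 0 0 1) => [y|]; first by rewrite /= gE; ring.
    by constructor 1; rewrite oner_neq0 orbT.
- case: s => [|[|[|[|[|[|]]]]]] // _ _ /norm_neq0 d_neq0.
  + apply: (ineq _ d 0 0 1) => [y|]; first by rewrite /=; ring.
    by constructor 1; rewrite oner_neq0 orbT.
  + apply: (ineq _ 1 0 0 d) => [y|]; first by rewrite /=; ring.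
    by constructor 1; rewrite oner_neq0.
move=> s3 /norm_neq0 d_neq0 V _; rewrite /V.
(* The residues of s modulo 6 are 1, 2, 4 and 5; adding 3 swaps 1 with 4 and 2 with 5. *)
have {}s3 : (s %% 6 %% 3 != 0)%N.
  by move: s3; rewrite coprime_sym prime_coprime // /dvdn modn_dvdm.
have gE y := qpow_modn dimL s y.
have gE3 y : qpow (s + 3) y = qpow ((s %% 6 + 3) %% 6) y :> L.
  by rewrite modnDml; apply: qpow_modn.
have : (s %% 6 < 6)%N by rewrite ltn_mod.
case: (s %% 6)%N s3 gE gE3 => [|[|[|[|[|[|]]]]]] // _ gE gE3 _.
- apply: (ineq _ d 0 1 0) => [y|]; first by rewrite /= gE gE3 /=; ring.
  by constructor 2.
- apply: (ineq _ 0 d 0 1) => [y|]; first by rewrite /= gE gE3 /=; ring.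
  by constructor 3; rewrite oner_neq0.
- apply: (ineq _ 1 0 d 0) => [y|]; first by rewrite /= gE gE3 /=; ring.
  by constructor 2; rewrite oner_neq0.
- apply: (ineq _ 0 1 0 d) => [y|]; first by rewrite /= gE gE3 /=; ring.
  by constructor 3.
Qed.
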